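(* Let $p,q$ be positive integers with $p\ge q$. A signed graph $\hat G=(G,\sigma)$ admits a $(2p,q)$-flow if and only if the graph $(2p-2q)G$ admits a $(\mathbb{Z}_{4p},\beta)$-orientation, where $\beta(v)\equiv 2p\cdot d^+(v)\pmod{4p}$ for every vertex $v\in V(G)$ and $d^+(v)$ is the number of positive edges of $\hat G$ incident to $v$.
   Context: Graphs are finite, may have multiple edges but no loops; $mG$ denotes the graph obtained from $G$ by replacing each edge with $m$ parallel edges. For an orientation $D$ and $f:E(G)\to\mathbb{Z}$, $\partial_Df(v)$ is the sum of $f$ over out-arcs at $v$ minus the sum over in-arcs. For an even integer $P$ and an integer $Q\le P/2$, a $(P,Q)$-flow in a signed graph is a pair $(D,f)$ with $D$ an orientation and $f:E(G)\to\mathbb{Z}$ such that $f(e)\in\{Q,\dots,P-Q\}$ for each positive edge, $f(e)\in\{0,\dots,\frac P2-Q\}\cup\{\frac P2+Q,\dots,P-1\}$ for each negative edge, and $\partial_Df(v)=0$ for every vertex. For a graph $H$ and a map $\beta:V(H)\to\mathbb{Z}$, a $(\mathbb{Z}_{m},\beta)$-orientation of $H$ is an orientation $D$ of $H$ such that for every vertex $v$, (out-degree of $v$) $-$ (in-degree of $v$) $\equiv\beta(v)\pmod m$. *)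

(* Defs.v *)
From mathcomp Require Import all_boot all_order all_algebra.

Set Implicit Arguments.
Unset Strict Implicit.
Unset Printing Implicit Defensive.

Import GRing.Theory Num.Theory.
Local Open Scope ring_scope.

(* Parallel edges are distinct edges with the same ends; the cardinality
   condition excludes loops. *)
Record multigraph := Multigraph {
  vertex : finType;
  edge : finType;
  ends : edge -> {set vertex};
  card_ends : forall e, #|ends e| = 2%N }.

Record signed_graph := SignedGraph {
  underlying :> multigraph;
  positive : edge underlying -> bool }.

Record orientation (G : multigraph) := Orientation {
  tail : edge G -> vertex G;
  head : edge G -> vertex G;
  ends_orientation : forall e, ends e = [set tail e; head e] }.

(* The graph mG. *)
Definition multiply (m : nat) (G : multigraph) : multigraph :=
  @Multigraph (vertex G) (edge G * 'I_m)%type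
    (fun e => ends e.1) (fun e => card_ends e.1).

Definition boundary (G : multigraph) (D : orientation G) (f : edge G -> int)
    (v : vertex G) : int :=
  \sum_(e | tail D e == v) f e - \sum_(e | head D e == v) f e.

(* Only meaningful for even P and Q <= P / 2. *)
Definition is_flow (P Q : int) (S : signed_graph) (D : orientation S)
    (f : edge S -> int) : Prop :=
  [/\ forall e, positive e -> Q <= f e <= P - Q,
      forall e, ~~ positive e ->
        (0 <= f e <= (P %/ 2)%Z - Q) || ((P %/ 2)%Z + Q <= f e <= P - 1)
    & forall v, boundary D f v = 0].

Definition admits_flow (P Q : int) (S : signed_graph) : Prop :=
  exists (D : orientation S) (f : edge S -> int), is_flow P Q D f.

Definition outdeg (G : multigraph) (D : orientation G) (v : vertex G) : nat :=
  #|[set e | tail D e == v]|.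

Definition indeg (G : multigraph) (D : orientation G) (v : vertex G) : nat :=
  #|[set e | head D e == v]|.

Definition is_Z_orientation (m : nat) (H : multigraph) (beta : vertex H -> int)
    (D : orientation H) : Prop :=
  forall v, ((outdeg D v)%:Z - (indeg D v)%:Z = beta v %[mod m%:Z])%Z.

Definition admits_Z_orientation (m : nat) (H : multigraph)
    (beta : vertex H -> int) : Prop :=
  exists D : orientation H, is_Z_orientation m beta D.

Definition pos_degree (S : signed_graph) (v : vertex S) : nat :=
  #|[set e : edge S | positive e && (v \in ends e)]|.

(* Main.v *)
(** Fix an orientation of G.  An orientation of (2p-2q)G amounts to an integer
    2y(e) for each edge e, its net number of forward copies, with
    |y(e)| <= p - q.  Put g := y + p on positive edges and g := y on negative
    ones; the degree condition modulo 4p then says that g has boundary 0 modulo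
    2p, and the bounds on y are the flow bounds modulo 2p.  By Tutte's argument g
    can be changed by multiples of 2p, staying in ]-2p, 2p[, until its boundary
    vanishes: as long as some vertex has an excess, a residual path leads from it
    to a deficit, and shifting by 2p along this path reduces the total imbalance.
    Reversing the edges of negative value yields the flow, since the admissible
    sets of nonzero values are invariant under x |-> 2p - x. *)

From mathcomp Require Import all_boot all_order all_algebra.
From mathcomp Require Import zify ring lra.
Require Import Defs.

Set Implicit Arguments.
Unset Strict Implicit.
Unset Printing Implicit Defensive.

Import Order.TTheory GRing.Theory Num.Theory.

Local Open Scope ring_scope.

(** * Incidence signs and change of orientation *)

Definition incidence (G : multigraph) (D : orientation G) (e : edge G)
    (v : vertex G) : int :=
  (tail D e == v)%:R - (head D e == v)%:R.

Lemma boundaryE (G : multigraph) (D : orientation G) (f : edge G -> int)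
    (v : vertex G) :
  boundary D f v = \sum_e f e * incidence D e v.
Proof.
rewrite /boundary /incidence big_mkcond [X in _ - X]big_mkcond -sumrB /=.
by apply: eq_bigr => e _; do 2 case: (_ == v); rewrite /=; ring.
Qed.

Lemma degree_incidence (G : multigraph) (D : orientation G) (v : vertex G) :
  (outdeg D v)%:Z - (indeg D v)%:Z = \sum_e incidence D e v.
Proof.
have cardZ (P : pred (edge G)) : #|[set e | P e]|%:Z = \sum_e (P e)%:R.
  rewrite -sum1_card -natz natr_sum big_mkcond /=.
  by apply: eq_bigr => e _; rewrite inE; case: (P e).
by rewrite /outdeg /indeg !cardZ -sumrB.
Qed.

Lemma tail_neq_head (G : multigraph) (D : orientation G) (e : edge G) :
  tail D e != head D e.
Proof.
have := card_ends e; rewrite (ends_orientation D).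
by rewrite cards2; case: eqP.
Qed.

Definition dirsign (G : multigraph) (D D' : orientation G) (e : edge G) : int :=
  if tail D' e == tail D e then 1 else -1.

(** Without loops, two orientations of an edge either agree or swap its two distinct ends, so
    comparing tails decides the sign. *)
Lemma incidence_reorient (G : multigraph) (D D' : orientation G) (e : edge G)
    (v : vertex G) :
  incidence D' e v = dirsign D D' e * incidence D e v.
Proof.
rewrite /dirsign /incidence.
have := ends_orientation D e; rewrite (ends_orientation D' e) => E.
have ntD := tail_neq_head D e; have ntD' := tail_neq_head D' e.
have: tail D' e \in [set tail D e; head D e] by rewrite -E set21.
have: head D' e \in [set tail D e; head D e] by rewrite -E set22.
rewrite !inE => /orP[]/eqP h /orP[]/eqP t; move: ntD ntD'; rewrite h t.
- by rewrite eqxx.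
- by move=> nt _; rewrite [head D e == tail D e]eq_sym (negbTE nt); ring.
- by rewrite eqxx; move=> _ _; ring.
- by rewrite eqxx.
Qed.

Lemma exists_orientation (G : multigraph) : exists D : orientation G, True.
Proof.
have ex (e : edge G) : exists t : vertex G * vertex G, ends e = [set t.1; t.2].
  have /eqP/cards2P[x [y [_ ->]]] := card_ends e.
  by exists (x, y).
have [t tE] := fin_all_exists ex.
by exists (Orientation tE).
Qed.

Lemma reorient_ends (G : multigraph) (D : orientation G) (b : edge G -> bool)
    (e : edge G) :
  ends e = [set if b e then tail D e else head D e;
                if b e then head D e else tail D e].
Proof. by rewrite (ends_orientation D); case: (b e); rewrite // setUC. Qed.

Definition reorient (G : multigraph) (D : orientation G) (b : edge G -> bool) :
  orientation G := Orientation (reorient_ends D b).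

Lemma dirsign_reorient (G : multigraph) (D : orientation G)
    (b : edge G -> bool) (e : edge G) :
  dirsign D (reorient D b) e = if b e then 1 else -1.
Proof.
rewrite /dirsign /=; case: (b e); first by rewrite eqxx.
by rewrite eq_sym (negbTE (tail_neq_head _ _)).
Qed.

Definition multiply_orientation (m : nat) (G : multigraph) (D : orientation G) :
  orientation (multiply m G) :=
  @Orientation (multiply m G) (fun e => tail D e.1) (fun e => head D e.1)
    (fun e => ends_orientation D e.1).

(** Summing signs over the copies of an edge gives its net number of forward copies, so a degree
    condition on [multiply m G] becomes a boundary condition on [G]. *)
Lemma multiply_degree (m : nat) (G : multigraph) (D : orientation G)
    (D' : orientation (multiply m G)) (v : vertex G) :
  (outdeg D' v)%:Z - (indeg D' v)%:Z =
  boundary D (fun e => \sum_(i < m) dirsign (multiply_orientation m D) D' (e, i)) v.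
Proof.
rewrite degree_incidence boundaryE.
transitivity (\sum_e \sum_(i < m) incidence D' (e, i) v).
  by rewrite pair_big; apply: eq_bigr => -[].
apply: eq_bigr => e _; rewrite mulr_suml; apply: eq_bigr => i _.
exact: incidence_reorient.
Qed.

(** * Residual paths and Tutte's lifting of modular flows *)

Definition residual (G : multigraph) (D : orientation G) (g : edge G -> int) :
  rel (vertex G) :=
  fun x y => [exists e, [&& 0 < g e, tail D e == x & head D e == y]
                     || [&& g e < 0, head D e == x & tail D e == y]].

(** Moving a nonzero value by [k] against its sign keeps it strictly between [-k] and [k], and
    carries [k] units of boundary along the residual arc. *)
Lemma push_path (G : multigraph) (D : orientation G) (k : int)
    (s : seq (vertex G)) (g : edge G -> int) (v : vertex G) :
  0 < k -> (forall e, `|g e| < k) ->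
  path (residual D g) v s -> uniq (v :: s) ->
  exists h : edge G -> int,
    [/\ forall e, `|h e| < k,
        forall e, (k %| h e - g e)%Z
      & forall w, boundary D h w =
          boundary D g w - k * (v == w)%:R + k * (last v s == w)%:R].
Proof.
move=> k_gt0; elim: s g v => [|w s IHs] g v gk.
  move=> _ _; exists g; split=> // [e|w]; first by rewrite subrr dvdz0.
  by rewrite /= subrK.
move=> /= /andP[/existsP[e he] pws] /and3P[vws ws us].
pose c := if 0 < g e then - k else k.
pose g1 (e' : edge G) := g e' + c * (e' == e)%:R.
have g1k e' : `|g1 e'| < k.
  rewrite /g1 /c; have := gk e'; case: eqP => [->|_] /=; last by rewrite mulr0 addr0.
  by case: ifP he => /=; lia.
have g1b x : boundary D g1 x = boundary D g x - k * (v == x)%:R + k * (w == x)%:R.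
  rewrite !boundaryE.
  under eq_bigr do rewrite /g1 mulrDl.
  rewrite big_split /= -addrA; congr (_ + _).
  rewrite (bigD1 e) //= big1 ?addr0 => [|e' /negbTE->]; last by rewrite mulr0 mul0r.
  rewrite eqxx mulr1 /incidence /c.
  have [/and3P[-> /eqP-> /eqP->]|/and3P[ge /eqP-> /eqP->]] := orP he; first by ring.
  by rewrite ltNge ltW //=; ring.
(* The rest of the path avoids [v], which is an end of [e], so its arcs come from edges that the
   shift leaves unchanged. *)
have pws1 : path (residual D g1) w s.
  apply: (sub_in_path (P := fun x => x != v)) pws => [x y xv yv /existsP[e' he']|].
    apply/existsP; exists e'; rewrite /g1.
    suff /negbTE-> : e' != e by rewrite mulr0 addr0.
    apply: contraNneq xv => ee'.
    move: he' he; rewrite ee'.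
    case/orP=> /and3P[ge /eqP tx /eqP hy] /orP[]/and3P[ge' /eqP tv /eqP hw].
    - by rewrite -tx tv.
    - by lia.
    - by lia.
    - by rewrite -tx tv.
  by apply/allP=> x xs; apply: contraNneq vws => <-.
have [|h [hk hg hb]] := IHs g1 w g1k pws1 _; first by rewrite /= ws.
exists h; split=> // [e'|x].
  have -> : h e' - g e' = h e' - g1 e' + c * (e' == e)%:R by rewrite /g1; ring.
  apply: rpredD; first exact: hg.
  by apply: dvdz_mulr; rewrite /c; case: ifP => _; rewrite ?dvdzN ?rpredN dvdzz.
by rewrite hb g1b; ring.
Qed.

(* The vertices reachable from v in the residual graph have no positive net
   outflow in total, so an excess at v forces a deficit at one of them. *)
Lemma residual_deficit (G : multigraph) (D : orientation G) (g : edge G -> int)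
    (v : vertex G) :
  0 < boundary D g v ->
  exists2 u, connect (residual D g) v u & boundary D g u < 0.
Proof.
move=> bv; pose U u := connect (residual D g) v u.
have [/existsP[u /andP[]]|/existsPn nU] :=
  boolP [exists u, U u && (boundary D g u < 0)]; first by exists u.
have: 0 < \sum_(u | U u) boundary D g u.
  rewrite (bigD1 v) /=; last exact: connect0.
  apply: ltr_wpDr => //; apply: sumr_ge0 => u /andP[Uu _].
  by have := nU u; rewrite Uu /= -leNgt.
suff: \sum_(u | U u) boundary D g u <= 0 by lra.
under eq_bigr do rewrite boundaryE.
(* Each edge contributes its value times the difference of [U] at tail and head; closure of [U]
   under residual arcs makes this nonpositive. *)
rewrite exchange_big /=; apply: sumr_le0 => e _; rewrite -mulr_sumr.
have sum1 x : \sum_(u | U u) (x == u)%:R = (U x)%:R :> int.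
  rewrite big_mkcond (bigD1 x) //= eqxx big1 ?addr0; first by case: (U x).
  by move=> u; rewrite eq_sym => /negbTE->; case: ifP.
rewrite sumrB !sum1.
have step x y : residual D g x y -> U x ==> U y.
  by move=> xy; apply/implyP=> Ux; exact: connect_trans Ux (connect1 xy).
have [g0|g0|->] := ltgtP (g e) 0; last by rewrite mul0r.
- have: U (head D e) ==> U (tail D e).
    by apply: step; apply/existsP; exists e; rewrite g0 !eqxx orbT.
  by case: (U _); case: (U _) => //= _; lia.
- have: U (tail D e) ==> U (head D e).
    by apply: step; apply/existsP; exists e; rewrite g0 !eqxx.
  by case: (U _); case: (U _) => //= _; lia.
Qed.

Lemma sum_boundary (G : multigraph) (D : orientation G) (g : edge G -> int) :
  \sum_v boundary D g v = 0.
Proof.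
under eq_bigr do rewrite boundaryE.
rewrite exchange_big big1 //= => e _; rewrite -mulr_sumr sumrB.
have sum1 x : \sum_u (x == u)%:R = 1 :> int.
  rewrite (bigD1 x) //= eqxx big1 ?addr0 // => u.
  by rewrite eq_sym => /negbTE->.
by rewrite !sum1 subrr mulr0.
Qed.

Lemma modular_flow_lift (G : multigraph) (D : orientation G) (k : int)
    (g : edge G -> int) :
  0 < k -> (forall e, `|g e| < k) -> (forall v, (k %| boundary D g v)%Z) ->
  exists h : edge G -> int,
    [/\ forall e, `|h e| < k,
        forall e, (k %| h e - g e)%Z
      & forall v, boundary D h v = 0].
Proof.
move=> k_gt0; have [n] := ubnP (\sum_v `|boundary D g v|)%N.
elim: n g => // n IHn g; rewrite ltnS => gn gk gd.
have [/forallP b0|] := boolP [forall v, boundary D g v <= 0].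
  (* Boundaries sum to zero, so they all vanish once none is positive. *)
  exists g; split=> // [e|v]; first by rewrite subrr dvdz0.
  apply/eqP; rewrite eq_le b0 /=.
  rewrite -(sum_boundary D g) (bigD1 v) //= gerDl.
  by apply: sumr_le0 => u _.
rewrite negb_forall => /existsP[v]; rewrite -ltNge => bv.
have [u /connectP[s0 ps0 lu] bu] := residual_deficit bv.
move: lu; case/shortenP: ps0 => s ps us _ lu.
have [h [hk hg hb]] := push_path k_gt0 gk ps us.
have uv : v != u by apply: contraTneq bu => <-; rewrite -leNgt ltW.
(* Boundaries are multiples of [k], so excess and deficit have size at least [k], and the push
   lowers the total imbalance by [2k]. *)
have kv : k <= boundary D g v.
  by have /dvdzP[c cE] := gd v; move: bv; rewrite cE pmulr_lgt0 //; nia.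
have ku : boundary D g u <= - k.
  by have /dvdzP[c cE] := gd u; move: bu; rewrite cE pmulr_llt0 //; nia.
have [|//|w|h' [h'k h'h h'b]] := IHn h.
- apply: leq_trans gn.
  rewrite (bigD1 v) //= (bigD1 u) 1?eq_sym //=.
  rewrite [X in (_ < X)%N](bigD1 v) //= [X in (_ < _ + X)%N](bigD1 u) 1?eq_sym //=.
  rewrite !hb -lu !eqxx (negbTE uv) eq_sym (negbTE uv).
  rewrite (eq_bigr (fun w => `|boundary D g w|%N)) => [|w /andP[wv wu]]; first by lia.
  by rewrite hb -lu eq_sym (negbTE wv) eq_sym (negbTE wu) !mulr0 subr0 addr0.
- rewrite hb; apply: rpredD; last exact/dvdz_mulr/dvdzz.
  by apply: rpredB; [exact: gd | exact/dvdz_mulr/dvdzz].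
exists h'; split=> // e.
rewrite -(subrK (h e) (h' e)) -addrA.
by apply: rpredD; [exact: h'h | exact: hg].
Qed.

(** * Boundary arithmetic, parity and sums of signs *)

Lemma boundary_norm (G : multigraph) (D : orientation G) (h : edge G -> int)
    (v : vertex G) :
  boundary (reorient D (fun e => 0 <= h e)) (fun e => `|h e|) v = boundary D h v.
Proof.
rewrite !boundaryE; apply: eq_bigr => e _.
rewrite (incidence_reorient D) dirsign_reorient; case: ifP => he.
  by rewrite ger0_norm // mul1r.
by rewrite ltr0_norm; [ring | rewrite ltNge he].
Qed.

Lemma eq_boundary (G : multigraph) (D : orientation G) (f g : edge G -> int)
    (v : vertex G) :
  f =1 g -> boundary D f v = boundary D g v.
Proof. by move=> fg; rewrite !boundaryE; apply: eq_bigr => e _; rewrite fg. Qed.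

Lemma boundaryD (G : multigraph) (D : orientation G) (f g : edge G -> int)
    (v : vertex G) :
  boundary D (fun e => f e + g e) v = boundary D f v + boundary D g v.
Proof.
by rewrite !boundaryE -big_split; apply: eq_bigr => e _; rewrite mulrDl.
Qed.

Lemma boundaryZ (G : multigraph) (D : orientation G) (c : int)
    (f : edge G -> int) (v : vertex G) :
  boundary D (fun e => c * f e) v = c * boundary D f v.
Proof.
by rewrite !boundaryE mulr_sumr; apply: eq_bigr => e _; rewrite mulrA.
Qed.

(** Modulo 2 the signs of incidences disappear, and each positive edge at [v] counts once. *)
Lemma boundary_positive (S : signed_graph) (D : orientation S) (v : vertex S) :
  (2 %| boundary D (fun e => (positive e)%:R) v - (pos_degree v)%:Z)%Z.
Proof.
rewrite boundaryE /pos_degree -sum1_card -[X in _ - X]natz natr_sum.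
rewrite [X in _ - X]big_mkcond -sumrB /=.
apply: rpred_sum => e _; rewrite inE (ends_orientation D) !inE /incidence.
case: (positive e); rewrite /= ?mul0r //.
rewrite ![v == _]eq_sym; have := tail_neq_head D e.
by case: (tail D e =P v) => [->|_]; case: (head D e =P v) => [->|_]; rewrite ?eqxx.
Qed.

(** Directing the first [k] of [m] copies forward realises a prescribed net number. *)
Lemma sum_sign_lt (m k : nat) :
  (k <= m)%N -> \sum_(i < m) (if (i < k)%N then 1 else -1) = 2 * k%:Z - m%:Z.
Proof.
elim: m k => [|m IHm] k; first by rewrite leqn0 => /eqP->; rewrite big_ord0.
rewrite big_ord_recr /= leq_eqVlt => /orP[/eqP->|km].
  rewrite ltnSn (eq_bigr (fun=> 1)) => [|i _]; last by rewrite ltnS ltnW.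
  by rewrite sumr_const card_ord; lia.
by rewrite IHm // ltnNge -ltnS km /=; lia.
Qed.

(** Here [k] counts the forward copies in an arbitrary choice of directions. *)
Lemma sum_sign (m : nat) (b : 'I_m -> bool) :
  exists2 k : nat, (k <= m)%N
    & \sum_(i < m) (if b i then 1 else -1) = 2 * k%:Z - m%:Z.
Proof.
elim: m b => [|m IHm] b; first by exists 0%N => //; rewrite big_ord0.
rewrite big_ord_recr /=; have [k km ->] := IHm (fun i => b (widen_ord (leqnSn m) i)).
by case: (b ord_max); [exists k.+1 | exists k] => //; lia.
Qed.

(* Halving turns the degree condition modulo 4p into a condition modulo 2p,
   and shifting by p on the positive edges absorbs beta. *)
Lemma Z_orientation_boundary (p : nat) (S : signed_graph) (D : orientation S)
    (y : edge S -> int) (v : vertex S) :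
  (2 * boundary D y v = (2 * p * pos_degree v)%N%:Z %[mod (4 * p)%N%:Z])%Z <->
  ((2 * p)%N%:Z %| boundary D (fun e => y e + p%:Z * (positive e)%:R) v)%Z.
Proof.
have /dvdzP[c /eqP] := boundary_positive D v; rewrite subr_eq => /eqP cE.
rewrite boundaryD boundaryZ cE.
split.
  move/eqP; rewrite eqz_mod_dvd => /dvdzP[d dE].
  by apply/dvdzP; exists (d + c + (pos_degree v)%:Z); nia.
case/dvdzP=> d dE; apply/eqP; rewrite eqz_mod_dvd; apply/dvdzP.
by exists (d - c - (pos_degree v)%:Z); nia.
Qed.

Theorem theorem5p13 (p q : nat) (p_gt0 : (0 < p)%N) (q_gt0 : (0 < q)%N)
    (le_qp : (q <= p)%N) (S : signed_graph) (beta : vertex S -> int)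
    (betaE : forall v : vertex S,
      (beta v = (2 * p * pos_degree v)%N%:Z %[mod (4 * p)%N%:Z])%Z) :
  admits_flow (2 * p)%N%:Z q%:Z S <->
  @admits_Z_orientation (4 * p)%N (multiply (2 * p - 2 * q)%N S) beta.
Proof.
have half : ((2 * p)%N%:Z %/ 2)%Z = p%:Z by rewrite PoszM mulKz.
set m := (2 * p - 2 * q)%N.
split=> [[D [f [fpos fneg fb]]]|[D' D'b]].
  (* Positive values are recentred by [p]; negative edges in the upper range, exactly those with
     [f e > p], drop by [2p]. Hence [|y e| <= p - q]. *)
  pose y e : int := f e - p%:Z * (positive e)%:R
              - (2 * p)%N%:Z * (~~ positive e && (p%:Z < f e))%:R.
  (* The solution of [2k - m = 2y]; it is nonnegative, so [absz] loses nothing. *)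
  pose k e := absz (y e + p%:Z - q%:Z)%R.
  have kE e : (k e <= m)%N /\ 2 * (k e)%:Z - m%:Z = 2 * y e.
    rewrite /k /y /m; have := fpos e; have := fneg e; rewrite half.
    by case: (positive e) => /=; case: (ltP p%:Z (f e)) => /=; lia.
  exists (reorient (multiply_orientation m D) (fun e => (e.2 < k e.1)%N)) => v.
  rewrite betaE (multiply_degree D).
  rewrite (@eq_boundary _ _ _ (fun e => 2 * y e)) => [|e]; last first.
    have [km <-] := kE e; rewrite -sum_sign_lt //.
    by apply: eq_bigr => i _; rewrite dirsign_reorient.
  rewrite boundaryZ; apply/Z_orientation_boundary.
  rewrite (@eq_boundary _ _ _ (fun e => f e + (2 * p)%N%:Z *
     - (~~ positive e && (p%:Z < f e))%:R)) => [|e]; last by rewrite /y; ring.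
  by rewrite boundaryD fb add0r boundaryZ dvdz_mulr.
have [D _] := exists_orientation S.
have /fin_all_exists2[k km kE] e :=
  sum_sign (fun i : 'I_m => tail D' (e, i) == tail D e).
pose y e : int := (k e)%:Z - p%:Z + q%:Z.
pose g e : int := y e + p%:Z * (positive e)%:R.
have gb v : ((2 * p)%N%:Z %| boundary D g v)%Z.
  apply/Z_orientation_boundary; rewrite -betaE -D'b (multiply_degree D) -boundaryZ.
  congr (_ %% _)%Z; apply: eq_boundary => e.
  by rewrite [RHS]kE /y /m; lia.
(* Positive edges have [g] between [q] and [2p - q], negative ones have [|g| <= p - q]; [q > 0]
   makes the bound strict. *)
have gk e : `|g e| < (2 * p)%N%:Z.
  by rewrite /g /y; have := km e; rewrite /m; case: (positive e) => /=; lia.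
have [|h [hk hg hb]] := modular_flow_lift _ gk gb; first by lia.
exists (reorient D (fun e => 0 <= h e)), (fun e => `|h e|).
have hE e : [\/ h e = g e, h e = g e + (2 * p)%N%:Z | h e = g e - (2 * p)%N%:Z].
  have /dvdzP[c cE] := hg e; have := hk e; have := gk e => g2 h2.
  have c2 : -2 < c < 2 by nia.
  have [c1|[c1|c1]] : c = 0 \/ c = 1 \/ c = -1 by lia.
  - by apply: Or31; move: cE; rewrite c1; lia.
  - by apply: Or32; move: cE; rewrite c1; lia.
  - by apply: Or33; move: cE; rewrite c1; lia.
split=> [e pe|e pe|v]; last by rewrite boundary_norm.
  (* As [g e >= q > 0], only [g e] and [g e - 2p] remain possible. *)
  by have := km e; have := hk e; have := hE e; rewrite /g /y pe /m /=; case=> ->; lia.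
(* An unshifted value falls in the lower range; a shifted one has size at least [p + q] and, by
   [hk], at most [2p - 1]. *)
have := km e; have := hk e; have := hE e.
by rewrite half /g /y (negbTE pe) /m /=; case=> ->; lia.
Qed.
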